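(* Suppose the length space $(X,d)$ is a $5$-point limit of a sequence of metric spaces $(X_m,d_m)$, $m\in\mathbb{N}$, where $(X_m,d_m)$ is $C_m$-rCAT$(0;* )$ for some constant $C_m$. If there is a constant $C$ with $C_m\le C$ for all $m\in\mathbb{N}$, then $(X,d)$ is a $\widetilde{C}$-rCAT$(0)$ space, where $\widetilde{C}=3C+2\sqrt{3}$. If $C_m\to 0$ and $(X,d)$ is complete, then $(X,d)$ is a CAT$(0)$ space.
   Context: $\mathbb{R}^2$ carries the Euclidean metric $|\cdot-\cdot|$. Short segments. Let $(X,d)$ be a metric space and $h\ge 0$. An $h$-short segment in $X$ is a path $\gamma:[0,L]\to X$, $L\ge 0$, with $\mathrm{len}(\gamma)\ge d(\gamma(0),\gamma(L))\ge \mathrm{len}(\gamma)-h$, where $\mathrm{len}$ is path length. $[x,y]_h$ denotes an $h$-short segment from $x$ to $y$ (and also its image). For a point $z=\gamma(t)$ of such a path, $[x,z]_h$ and $[z,y]_h$ denote the subpaths $\gamma|_{[0,t]}$ and $\gamma|_{[t,L]}$. A geodesic segment $[x,y]$ is a $0$-short segment. $(X,d)$ is a length space if for every $x,y\in X$ and every $h>0$ there is an $h$-short segment $[x,y]_h$; it is geodesic if every two points are joined by a geodesic segment. Triangles. An $h$-short triangle $T_h(x_1,x_2,x_3)$ with vertices $x_1,x_2,x_3\in X$ is a collection of $h$-short segments $[x_1,x_2]_h,[x_2,x_3]_h,[x_3,x_1]_h$ (its sides). A comparison triangle is a Euclidean triangle $T(\bar x_1,\bar x_2,\bar x_3)$ in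 $\mathbb{R}^2$ with $|\bar x_i-\bar x_j|=d(x_i,x_j)$ for $i,j\in\{1,2,3\}$. A point $\bar u\in[\bar x_i,\bar x_j]$ is a comparison point for $u\in[x_i,x_j]_h$ if $|\bar x_i-\bar u|\le \mathrm{len}([x_i,u]_h)$ and $|\bar u-\bar x_j|\le \mathrm{len}([u,x_j]_h)$. A geodesic triangle is a $0$-short triangle (then the comparison point is determined by $|\bar x_i-\bar u|=d(x_i,u)$). CAT(0). A geodesic space $(X,d)$ is CAT$(0)$ if for every geodesic triangle $T(x,y,z)$ with comparison triangle $T(\bar x,\bar y,\bar z)$ and any $u\in[x,y]$, $v\in[x,z]$, we have $d(u,v)\le|\bar u-\bar v|$, where $\bar u,\bar v$ are the comparison points for $u,v$. Rough CAT(0). Given $C>0$ and $H:X\times X\times X\to(0,\infty)$, a length space $(X,d)$ is $C$-rCAT$(0;H)$ if $d(u,v)\le|\bar u-\bar v|+C$ whenever $x,y,z\in X$, $T=T_h(x,y,z)$ is an $h$-short triangle with $h=H(x,y,z)$, $\bar T=T(\bar x,\bar y,\bar z)$ is a comparison triangle in $\mathbb{R}^2$ for $T$, $u,v$ lie on different sides of $T$, and $\bar u,\bar v\in\bar T$ are comparison points for $u,v$ respectively. $(X,d)$ is $C$-rCAT$(0;* )$ if there exists $H:X\times X\times X\to(0,\infty)$ such that it is $C$-rCAT$(0;H)$. $(X,d)$ is $C$-rCAT$(0)$ if it is $C$-rCAT$(0;H)$ with $H(x,y,z)=1/\max\{1,d(x,y),d(x,z),d(y,z)\}$. $n$-point limit.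 A metric space $(X,d)$ is an $n$-point limit of a sequence of metric spaces $(X_m,d_m)$, $m\in\mathbb{N}$, if for every $\{x_i\}_{i=1}^n\subset X$ and $\varepsilon>0$ there exist infinitely many integers $m$ and points $x_i(m)\in X_m$, $1\le i\le n$, such that $|d(x_i,x_j)-d_m(x_i(m),x_j(m))|<\varepsilon$ for $1\le i,j\le n$. *)

(* Defs.v *)
From HB Require Import structures.
From mathcomp Require Export all_boot all_order all_algebra.
From mathcomp Require Export all_classical all_reals all_analysis.

Set Implicit Arguments.
Unset Strict Implicit.
Unset Printing Implicit Defensive.

Import Order.TTheory GRing.Theory Num.Theory.
Import numFieldNormedType.Exports.

Local Open Scope classical_set_scope.
Local Open Scope ring_scope.

(* The library puts the sup norm on 'rV[R]_2, whence an explicit Euclidean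
   distance. *)
Definition edist (R : realType) (p q : 'rV[R]_2) : R :=
  Num.sqrt (\sum_(k < 2) (p 0 k - q 0 k) ^+ 2).

Definition esegment (R : realType) (p q : 'rV[R]_2) : set 'rV[R]_2 :=
  [set (1 - s) *: p + s *: q | s in `[0, 1]].

(* A path [0, L] -> X is carried by a function on R of which only the values on
   [0, L] matter. *)
Record path_in (R : realType) (X : metricType R) := PathIn {
  path_end : R;
  path_fun :> R -> X;
  path_end_ge0 : 0 <= path_end;
  path_continuous : {within `[0, path_end], continuous path_fun}
}.

Section paths.
Context {R : realType} {X : metricType R}.
Implicit Types (x y : X) (g : path_in X).

(* The analogue, for maps into a metric space, of [variation] and
   [total_variation]. *)
Definition metric_variation (a b : R) (f : R -> X) (s : seq R) : R :=
  let F := f \o nth b (a :: s) in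
  \sum_(0 <= n < size s) mdist (F n) (F n.+1).

Definition len_between (a b : R) (f : R -> X) : \bar R :=
  ereal_sup [set (metric_variation a b f s)%:E | s in itv_partition a b].

Definition len g : \bar R := len_between 0 (path_end g) g.

Definition short_segment (h : R) x y g : Prop :=
  [/\ g 0 = x, g (path_end g) = y,
      ((mdist x y)%:E <= len g)%E &
      (len g - h%:E <= (mdist x y)%:E)%E].

(* The i-th side joins the vertices x i and x (i + 1), with i + 1 taken
   modulo 3. *)
Definition short_triangle (h : R) (x : 'I_3 -> X) (g : 'I_3 -> path_in X) :
    Prop :=
  forall i, short_segment h (x i) (x (i + 1)) (g i).

Definition comparison_triangle (x : 'I_3 -> X) (xb : 'I_3 -> 'rV[R]_2) : Prop :=
  forall i j, edist (xb i) (xb j) = mdist (x i) (x j).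

(* ub is a comparison point on the segment from pb to qb for the point g t. *)
Definition comparison_point (pb qb : 'rV[R]_2) g (t : R) (ub : 'rV[R]_2) :
    Prop :=
  [/\ esegment pb qb ub,
      ((edist pb ub)%:E <= len_between 0 t g)%E &
      ((edist ub qb)%:E <= len_between t (path_end g) g)%E].

End paths.

Section spaces.
Context {R : realType}.

Definition length_space (X : metricType R) : Prop :=
  forall (x y : X) (h : R), 0 < h -> exists g, short_segment h x y g.

Definition geodesic_space (X : metricType R) : Prop :=
  forall x y : X, exists g, short_segment 0 x y g.

(* Every Cauchy sequence converges; the library's [completeType] also requires a
   distinguished point. *)
Definition complete_space (X : metricType R) : Prop :=
  forall u : nat -> X, cauchy (u @ \oo) -> exists l : X, u @ \oo --> l.

(* u lies on the side 0, which is [x, y], and v on the side 2, which is [z, x]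
   and whose orientation is immaterial. *)
Definition cat0 (X : metricType R) : Prop :=
  geodesic_space X /\
  forall (x : 'I_3 -> X) (g : 'I_3 -> path_in X) (xb : 'I_3 -> 'rV[R]_2)
         (t s : R) (ub vb : 'rV[R]_2),
    short_triangle 0 x g ->
    comparison_triangle x xb ->
    t \in `[0, path_end (g 0)] ->
    s \in `[0, path_end (g 2)] ->
    comparison_point (xb 0) (xb 1) (g 0) t ub ->
    comparison_point (xb 2) (xb 0) (g 2) s vb ->
    mdist (g 0 t) (g 2 s) <= edist ub vb.

Definition rcat0_with (C : R) (X : metricType R) (H : X -> X -> X -> R) : Prop :=
  [/\ 0 < C, (forall x y z, 0 < H x y z), length_space X &
  forall (x : 'I_3 -> X) (g : 'I_3 -> path_in X) (xb : 'I_3 -> 'rV[R]_2)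
         (i j : 'I_3) (t s : R) (ub vb : 'rV[R]_2),
    short_triangle (H (x 0) (x 1) (x 2)) x g ->
    comparison_triangle x xb ->
    i != j ->
    t \in `[0, path_end (g i)] ->
    s \in `[0, path_end (g j)] ->
    comparison_point (xb i) (xb (i + 1)) (g i) t ub ->
    comparison_point (xb j) (xb (j + 1)) (g j) s vb ->
    mdist (g i t) (g j s) <= edist ub vb + C].

Definition rcat0_star (C : R) (X : metricType R) : Prop :=
  exists H : X -> X -> X -> R, rcat0_with C H.

Definition rcat0 (C : R) (X : metricType R) : Prop :=
  rcat0_with C (fun x y z : X =>
    1 / Num.max 1 (Num.max (mdist x y) (Num.max (mdist x z) (mdist y z)))).

Definition n_point_limit (n : nat) (X : metricType R)
    (X_ : nat -> metricType R) : Prop :=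
  forall (x : 'I_n -> X) (e : R), 0 < e ->
    infinite_set [set m | exists xm : 'I_n -> X_ m,
      forall i j, `|mdist (x i) (x j) - mdist (xm i) (xm j)| < e].

End spaces.

(* Main.v *)
Require Import Defs.
From mathcomp Require Import ring lra.
Import Order.TTheory GRing.Theory Num.Theory.
Import numFieldNormedType.Exports.

Set Implicit Arguments.
Unset Strict Implicit.
Unset Printing Implicit Defensive.

Local Open Scope classical_set_scope.
Local Open Scope ring_scope.

(* Inside X_m put short segments along the sides of the approximating
   triangle and mark on them the points at the prescribed fractions of the
   sides. The rough CAT(0) condition is applied three times: to the triangle
   itself, and, for each of u and v, to the thin triangle spanned by that
   point and its side. Hence d(u, v) is at most the planar comparison
   distance plus two heights of thin triangles plus 3 C_m. By the law of
   cosines every term is the square root of a polynomial in the mutual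
   distances of the five points, so the estimate passes to the limit X. By
   Stewart's theorem the square of the height over a side of an h-short
   triangle is at most 2 h d + h^2, where d is the length of the Euclidean
   side; this is at most 3 for the h of rCAT(0), and 0 for h = 0.

   If C_m -> 0, the same estimate for a degenerate triangle shows that the
   points at a given fraction of almost shortest paths from x to y form a
   Cauchy sequence and that their limits trace a geodesic. *)

(** * Planar geometry and the existence of comparison triangles *)

(* The squared Euclidean distance between (1 - l) p + l q and (1 - m) r + m s,
   written in terms of the mutual distances D. For r = s it is Stewart's
   theorem. *)
Definition affine_sqdist (R : realType) (T : Type) (D : T -> T -> R)
    (p q r s : T) (l m : R) : R :=
  (1 - l) * (1 - m) * D p r ^+ 2 + (1 - l) * m * D p s ^+ 2 +
  l * (1 - m) * D q r ^+ 2 + l * m * D q s ^+ 2 -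
  l * (1 - l) * D p q ^+ 2 - m * (1 - m) * D r s ^+ 2.

Lemma edistE (R : realType) (p q : 'rV[R]_2) :
  edist p q = Num.sqrt ((p 0 0 - q 0 0) ^+ 2 + (p 0 1 - q 0 1) ^+ 2).
Proof.
rewrite /edist big_ord_recl big_ord1.
by have -> : lift ord0 ord0 = 1 :> 'I_2 by apply/val_inj.
Qed.

Lemma edistC (R : realType) (p q : 'rV[R]_2) : edist p q = edist q p.
Proof. by rewrite !edistE; congr Num.sqrt; ring. Qed.

Lemma edistxx (R : realType) (p : 'rV[R]_2) : edist p p = 0.
Proof. by rewrite edistE !subrr expr0n /= addr0 sqrtr0. Qed.

Lemma sqr_edist (R : realType) (p q : 'rV[R]_2) :
  edist p q ^+ 2 = (p 0 0 - q 0 0) ^+ 2 + (p 0 1 - q 0 1) ^+ 2.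
Proof. by rewrite edistE sqr_sqrtr// addr_ge0 ?sqr_ge0. Qed.

Lemma edist_affine (R : realType) (p q r s : 'rV[R]_2) (l m : R) :
  edist ((1 - l) *: p + l *: q) ((1 - m) *: r + m *: s) =
  Num.sqrt (affine_sqdist (@edist R) p q r s l m).
Proof.
by rewrite edistE /affine_sqdist !sqr_edist !mxE; congr Num.sqrt; ring.
Qed.

Lemma edist_affinel (R : realType) (p q : 'rV[R]_2) (l : R) :
  0 <= l -> edist p ((1 - l) *: p + l *: q) = l * edist p q.
Proof.
move=> l0; rewrite !edistE !mxE.
rewrite -[in RHS](ger0_norm l0) -sqrtr_sqr -sqrtrM ?sqr_ge0//.
by congr Num.sqrt; ring.
Qed.

Lemma edist_affiner (R : realType) (p q : 'rV[R]_2) (l : R) :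
  l <= 1 -> edist ((1 - l) *: p + l *: q) q = (1 - l) * edist p q.
Proof.
rewrite -subr_ge0 => l0; rewrite !edistE !mxE.
rewrite -[in RHS](ger0_norm l0) -sqrtr_sqr -sqrtrM ?sqr_ge0//.
by congr Num.sqrt; ring.
Qed.

(** The points are (0, 0), (c, 0) and one of abscissa [t], whose squared height is nonnegative by
    Heron's factorization. *)
Lemma planar_triangle (R : realType) (a b c : R) :
  0 <= a -> 0 <= b -> 0 <= c -> a <= b + c -> b <= a + c -> c <= a + b ->
  exists p q r : 'rV[R]_2, [/\ edist p q = c, edist p r = b & edist q r = a].
Proof.
move=> a0 b0 c0 abc bac cab.
(* Law of cosines. For c = 0 the convention on division gives t = 0, which fits because then a =
   b. *)
pose t := (b ^+ 2 + c ^+ 2 - a ^+ 2) / (2 * c).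
pose pt (x y : R) : 'rV[R]_2 := \row_k if k == 0 then x else y.
have sqrtE (x y : R) : 0 <= y -> x = y ^+ 2 -> Num.sqrt x = y.
  by move=> y0 ->; rewrite sqrtr_sqr ger0_norm.
have tc : 2 * c * t = b ^+ 2 + c ^+ 2 - a ^+ 2.
  rewrite /t; have [c00|cn0] := eqVneq c 0.
    have -> : a = b by lra.
    by rewrite c00; ring.
  by field.
have tb : 0 <= b ^+ 2 - t ^+ 2.
  have [c00|cn0] := eqVneq c 0.
    by rewrite /t c00 mulr0 invr0 mulr0 expr0n subr0 sqr_ge0.
  have c_gt0 : 0 < c by rewrite lt_neqAle eq_sym cn0.
  have : 0 <= (2 * c) ^+ 2 * (b ^+ 2 - t ^+ 2).
    rewrite mulrBr -[X in _ - X]exprMn tc.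
    have -> : (2 * c) ^+ 2 * b ^+ 2 - (b ^+ 2 + c ^+ 2 - a ^+ 2) ^+ 2 =
      ((b + c - a) * (b + c + a)) * ((a + c - b) * (a + b - c)) by ring.
    by rewrite !mulr_ge0// ?subr_ge0// !addr_ge0.
  by rewrite pmulr_rge0// exprn_gt0// mulr_gt0.
exists (pt 0 0), (pt c 0), (pt t (Num.sqrt (b ^+ 2 - t ^+ 2))).
split; rewrite edistE !mxE /=; apply: sqrtE => //.
- by ring.
- rewrite !sub0r !sqrrN sqr_sqrtr//; ring.
- rewrite sub0r sqrrN sqr_sqrtr//.
  by have -> : a ^+ 2 = b ^+ 2 + c ^+ 2 - 2 * c * t; [rewrite tc; ring | ring].
Qed.

(** The third index is written [1 + 1] to match the endpoint [x (i + 1)] of the side i = 1. *)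
Lemma ord3_ind (P : 'I_3 -> Prop) : P 0 -> P 1 -> P (1 + 1) -> forall i, P i.
Proof.
move=> P0 P1 P2 [[|[|[|//]]] ?].
- by rewrite (_ : Ordinal _ = 0)//; exact/val_inj.
- by rewrite (_ : Ordinal _ = 1)//; exact/val_inj.
- by rewrite (_ : Ordinal _ = 1 + 1)//; exact/val_inj.
Qed.

Definition ord3_fun (T : Type) (a b c : T) (i : 'I_3) : T :=
  if i == 0 then a else if i == 1 then b else c.

Lemma comparison_triangle_exists (R : realType) (X : metricType R)
    (x : 'I_3 -> X) : exists xb, comparison_triangle x xb.
Proof.
have [||||||p [q [r [pq pr qr]]]] := @planar_triangle R
  (mdist (x 1) (x (1 + 1))) (mdist (x 0) (x (1 + 1))) (mdist (x 0) (x 1));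
  rewrite ?mdist_ge0//.
- by rewrite (addrC (mdist _ _)) (metric_sym (x 0) (x 1)) metric_triangle.
- by rewrite (addrC (mdist _ _)) metric_triangle.
- by rewrite (addrC (mdist _ _)) (metric_sym (x 1) (x (1 + 1))) metric_triangle.
exists (ord3_fun p q r).
by elim/ord3_ind; elim/ord3_ind; rewrite ?edistxx ?mdistxx//= edistC metric_sym.
Qed.

(** * Variation and length of paths *)

Section paths.
Context {R : realType} {X : metricType R}.
Implicit Types (x y : X) (g : path_in X) (f : R -> X) (s : seq R).

Lemma metric_variation_cons a b f t s :
  metric_variation a b f (t :: s) =
  mdist (f a) (f t) + metric_variation t b f s.
Proof. by rewrite /metric_variation /= big_nat_recl. Qed.

Lemma metric_variation_nil a b f : metric_variation a b f [::] = 0.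
Proof. by rewrite /metric_variation /= big_nil. Qed.

(** [b] is only the default of [nth], and every index read lies within [a :: s]. *)
Lemma metric_variation_default a b c f s :
  metric_variation a b f s = metric_variation a c f s.
Proof.
elim: s a => [|t s ih] a; first by rewrite !metric_variation_nil.
by rewrite !metric_variation_cons ih.
Qed.

Lemma metric_variation_cat a b f s t :
  metric_variation a b f (s ++ t) =
  metric_variation a b f s + metric_variation (last a s) b f t.
Proof.
elim: s a => [|c s ih] a; first by rewrite metric_variation_nil add0r.
by rewrite /= !metric_variation_cons ih addrA.
Qed.

Lemma metric_variation_le_len a b f s :
  itv_partition a b s -> ((metric_variation a b f s)%:E <= len_between a b f)%E.
Proof. by move=> ?; apply: ereal_sup_ubound; exists s. Qed.

Lemma mdist_le_len a b f :
  a <= b -> ((mdist (f a) (f b))%:E <= len_between a b f)%E.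
Proof.
rewrite le_eqVlt => /predU1P[->|ab].
  rewrite mdistxx -(metric_variation_nil b b f).
  by apply: metric_variation_le_len; split.
have -> : mdist (f a) (f b) = metric_variation a b f [:: b].
  by rewrite metric_variation_cons metric_variation_nil addr0.
by apply: metric_variation_le_len; exact: itv_partition1.
Qed.

Lemma len_between_ge0 a b f : a <= b -> (0 <= len_between a b f)%E.
Proof.
by move=> ab; apply: le_trans (mdist_le_len f ab); rewrite lee_fin mdist_ge0.
Qed.

(** Partitions of the two parts concatenate. The suprema are taken one after the other, each time
    subtracting the other term, so the right-hand length is first shown to be finite. *)
Lemma len_between_add a b c f :
  a <= c -> c <= b -> len_between a b f \is a fin_num ->
  (len_between a c f + len_between c b f <= len_between a b f)%E.
Proof.
move=> ac cb fin.
have cat s t : itv_partition a c s -> itv_partition c b t ->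
    ((metric_variation a c f s + metric_variation c b f t)%:E
      <= len_between a b f)%E.
  move=> [acs las] [cbt lat].
  rewrite (_ : _ + _ = metric_variation a b f (s ++ t)).
    apply: metric_variation_le_len; split.
      by rewrite cat_path acs (eqP las) cbt.
    by rewrite last_cat (eqP las).
  by rewrite metric_variation_cat (eqP las) (metric_variation_default a b c).
have cat_sup s : itv_partition a c s ->
    ((metric_variation a c f s)%:E + len_between c b f <= len_between a b f)%E.
  move=> acs; rewrite addeC -leeBrDr//; apply: ge_ereal_sup => _ [t cbt <-].
  by rewrite leeBrDr// -EFinD addrC cat.
have finr : len_between c b f \is a fin_num.
  rewrite ge0_fin_numE ?len_between_ge0//.
  have lenoo : (len_between a b f < +oo)%E by rewrite ltey_eq fin.
  apply: le_lt_trans lenoo.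
  apply: ge_ereal_sup => _ [t cbt <-].
  have [s acs] : exists s, itv_partition a c s.
    move: ac; rewrite le_eqVlt => /predU1P[->|ac]; first by exists [::].
    by exists [:: c]; exact: itv_partition1.
  apply: le_trans (cat _ _ acs cbt).
  by rewrite lee_fin lerDr; apply: sumr_ge0 => *; exact: mdist_ge0.
rewrite -leeBrDr//; apply: ge_ereal_sup => _ [s acs <-].
by rewrite leeBrDr// cat_sup.
Qed.

End paths.

(** * Short segments and the points at given fractions of them *)

Section short_segments.
Context {R : realType} {X : metricType R}.
Implicit Types (x y : X) (g : path_in X).

(** Shortness makes the total length finite, so both parts have real lengths, and superadditivity
    bounds their sum. Later estimates thus avoid extended reals. *)
Lemma short_segment_split h x y g t :
  short_segment h x y g -> t \in `[0, path_end g] ->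
  exists l1 l2 : R, [/\ len_between 0 t g = l1%:E,
    len_between t (path_end g) g = l2%:E,
    mdist x (g t) <= l1, mdist (g t) y <= l2 & l1 + l2 <= mdist x y + h].
Proof.
move=> [g0 gL xy_len len_xy]; rewrite in_itv/= => /andP[t0 tL].
have lenxy : (len g <= (mdist x y + h)%:E)%E by rewrite EFinD -leeBlDr.
have lenfin : len g \is a fin_num.
  rewrite ge0_fin_numE ?(le_lt_trans lenxy) ?ltry// len_between_ge0//.
  exact: path_end_ge0.
have lenD := len_between_add t0 tL lenfin.
have finl : len_between 0 t g \is a fin_num.
  rewrite ge0_fin_numE ?len_between_ge0//.
  rewrite (le_lt_trans _ (ltry (mdist x y + h)))//.
  apply: le_trans lenxy; apply: le_trans lenD.
  by rewrite -[leLHS]adde0 leeD2l// len_between_ge0.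
have finr : len_between t (path_end g) g \is a fin_num.
  rewrite ge0_fin_numE ?len_between_ge0//.
  rewrite (le_lt_trans _ (ltry (mdist x y + h)))//.
  apply: le_trans lenxy; apply: le_trans lenD.
  by rewrite -[leLHS]add0e leeD2r// len_between_ge0.
exists (fine (len_between 0 t g)), (fine (len_between t (path_end g) g)).
split; rewrite ?fineK//.
- by rewrite -lee_fin fineK// -g0 mdist_le_len.
- by rewrite -lee_fin fineK// -gL mdist_le_len.
- by rewrite -lee_fin EFinD !fineK// (le_trans lenD).
Qed.

Lemma short_segment_mono h h' x y g :
  h <= h' -> short_segment h x y g -> short_segment h' x y g.
Proof.
move=> hh' [g0 gL xy_len len_xy]; split => //.
by apply: le_trans len_xy; rewrite leeB// lee_fin.
Qed.

Lemma mdist_continuous x : continuous (mdist x : X -> R).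
Proof.
move=> y; apply/cvgrPdist_lt => e e0.
have : \forall z \near y, mdist y z < e.
  by apply/metricType_numDomainType.nbhs_mdistP; exists e.
apply: filterS => z yz; rewrite (le_lt_trans _ yz)//= ler_distl.
by rewrite lerBlDr metric_triangle (metric_sym y z) metric_triangle.
Qed.

(** Fractions are measured by distance from x, not by arc length: this distance runs continuously
    from 0 to d(x, y). *)
Lemma short_segment_ivt h x y g (l : R) :
  short_segment h x y g -> 0 <= l <= 1 ->
  exists2 t, t \in `[0, path_end g] & mdist x (g t) = l * mdist x y.
Proof.
move=> [g0 gL _ _] /andP[l0 l1].
have [|||t tI gt] := @IVT R (mdist x \o g) 0 (path_end g) (l * mdist x y).
- exact: path_end_ge0.
- apply: within_continuous_comp; last exact: path_continuous.
  by move=> z _; exact: mdist_continuous.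
- rewrite /= g0 gL mdistxx min_l ?mdist_ge0// max_r ?mdist_ge0//.
  by rewrite mulr_ge0 ?mdist_ge0// ler_piMl ?mdist_ge0.
by exists t.
Qed.

(** The first part is at least as long as d(x, g t) = l d(x, y); the second, by the triangle
    inequality, is at least (1 - l) d(x, y). *)
Lemma comparison_point_frac h x y g (l t : R) (xb yb : 'rV[R]_2) :
  short_segment h x y g -> 0 <= l <= 1 -> t \in `[0, path_end g] ->
  edist xb yb = mdist x y -> mdist x (g t) = l * mdist x y ->
  comparison_point xb yb g t ((1 - l) *: xb + l *: yb).
Proof.
move=> xyg l01 tI xyb gt; case/andP: (l01) => l0 l1.
rewrite /comparison_point.
have [l1' [l2' [-> -> xt ty _]]] := short_segment_split xyg tI.
split; first by exists l; rewrite //= in_itv/= l0.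
- by rewrite edist_affinel// xyb -gt lee_fin.
- rewrite edist_affiner// xyb lee_fin (le_trans _ ty)//.
  by rewrite mulrBl mul1r -gt lerBlDl metric_triangle.
Qed.

End short_segments.

(** * The rough CAT(0) condition in terms of mutual distances *)

Lemma affine_sqdist_comparison (R : realType) (X : metricType R)
    (x : 'I_3 -> X) (xb : 'I_3 -> 'rV[R]_2) (i j : 'I_3) (l m : R) :
  comparison_triangle x xb ->
  affine_sqdist (@edist R) (xb i) (xb (i + 1)) (xb j) (xb (j + 1)) l m =
  affine_sqdist (@mdist R X) (x i) (x (i + 1)) (x j) (x (j + 1)) l m.
Proof. by move=> xxb; rewrite /affine_sqdist !xxb. Qed.

Section rcat0.
Context {R : realType} {X : metricType R} (C : R) (H : X -> X -> X -> R).
Hypothesis XH : rcat0_with C H.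
Local Notation sqd := (affine_sqdist (@mdist R X)).

Lemma rcat0_sides (x : 'I_3 -> X) (g : 'I_3 -> path_in X) (i j : 'I_3)
    (t s l m : R) :
  short_triangle (H (x 0) (x 1) (x (1 + 1))) x g -> i != j ->
  0 <= l <= 1 -> 0 <= m <= 1 ->
  t \in `[0, path_end (g i)] -> s \in `[0, path_end (g j)] ->
  mdist (x i) (g i t) = l * mdist (x i) (x (i + 1)) ->
  mdist (x j) (g j s) = m * mdist (x j) (x (j + 1)) ->
  mdist (g i t) (g j s) <=
    Num.sqrt (sqd (x i) (x (i + 1)) (x j) (x (j + 1)) l m) + C.
Proof.
move=> xg ij l01 m01 tI sI gt gs.
have [xb xxb] := comparison_triangle_exists x.
case: XH => _ _ _ /(_ x g xb i j t s).
rewrite (_ : (2 : 'I_3) = 1 + 1)//.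
rewrite -(affine_sqdist_comparison _ _ _ _ xxb) -edist_affine; apply => //.
- exact: (comparison_point_frac (xg i)).
- exact: (comparison_point_frac (xg j)).
Qed.

Lemma rcat0_short_side x y w g t l h :
  short_segment h x y g -> h <= H x y w -> 0 <= l <= 1 ->
  t \in `[0, path_end g] -> mdist x (g t) = l * mdist x y ->
  mdist (g t) w <= Num.sqrt (sqd x y w w l 0) + C.
Proof.
move=> xyg hH l01 tI gt.
case: (XH) => _ Hpos Xlen _.
have [g1 yw] := Xlen y w _ (Hpos x y w).
have [g2 wx] := Xlen w x _ (Hpos x y w).
have [g20 _ _ _] := wx.
(* The vertex w is the point at fraction 0 of the side from w to x. *)
have := @rcat0_sides (ord3_fun x y w) (ord3_fun g g1 g2) 0 (1 + 1) t 0 l 0.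
have -> : (1 + 1 + 1 : 'I_3) = 0 by exact/val_inj.
rewrite /= g20.
have -> : sqd x y w x l 0 = sqd x y w w l 0 by rewrite /affine_sqdist; ring.
apply => //.
- by elim/ord3_ind => //; apply: short_segment_mono xyg.
- by rewrite lexx ler01.
- by rewrite in_itv/= lexx path_end_ge0.
- by rewrite mdistxx mul0r.
Qed.

(** The path u, g i t, g j s, v has three steps, each costing C. Nothing ties u and v to the sides;
    the two heights account for their position. *)
Lemma rcat0_five (x : 'I_3 -> X) (u v : X) (i j : 'I_3) (l m : R) :
  i != j -> 0 <= l <= 1 -> 0 <= m <= 1 ->
  mdist u v <=
    Num.sqrt (sqd (x i) (x (i + 1)) (x j) (x (j + 1)) l m) +
    Num.sqrt (sqd (x i) (x (i + 1)) u u l 0) +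
    Num.sqrt (sqd (x j) (x (j + 1)) v v m 0) + 3 * C.
Proof.
move=> ij l01 m01; case: (XH) => _ Hpos Xlen _.
(* Small enough for the same segments to serve in all three triangles. *)
pose h := Num.min (H (x 0) (x 1) (x (1 + 1)))
  (Num.min (H (x i) (x (i + 1)) u) (H (x j) (x (j + 1)) v)).
have h0 : 0 < h by rewrite !lt_min !Hpos.
have /choice[g xg] : forall k, exists g, short_segment h (x k) (x (k + 1)) g.
  by move=> k; exact: Xlen.
have [t tI gt] := short_segment_ivt (xg i) l01.
have [s sI gs] := short_segment_ivt (xg j) m01.
have tri : short_triangle (H (x 0) (x 1) (x (1 + 1))) x g.
  by move=> k; apply: short_segment_mono (xg k); rewrite /h ge_min lexx.
have uvH := rcat0_sides tri ij l01 m01 tI sI gt gs.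
have uH : mdist (g i t) u <= Num.sqrt (sqd (x i) (x (i + 1)) u u l 0) + C.
  by apply: (rcat0_short_side (xg i)) => //; rewrite /h !ge_min lexx orbT.
have vH : mdist (g j s) v <= Num.sqrt (sqd (x j) (x (j + 1)) v v m 0) + C.
  by apply: (rcat0_short_side (xg j)) => //; rewrite /h !ge_min lexx !orbT.
have := metric_triangle u (g i t) v.
have := metric_triangle (g i t) (g j s) v.
rewrite (metric_sym u (g i t)).
lra.
Qed.

End rcat0.

(** * Passage to the 5-point limit *)

Lemma cvg_affine_sqdist (R : realType) (T : Type) (D_ : nat -> T -> T -> R)
    (D : T -> T -> R) (p q r s : T) (l m : R) :
  (forall a b, D_ n a b @[n --> \oo] --> D a b) ->
  affine_sqdist (D_ n) p q r s l m @[n --> \oo] --> affine_sqdist D p q r s l m.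
Proof.
move=> DD; have D2 c a b : c * D_ n a b ^+ 2 @[n --> \oo] --> c * D a b ^+ 2.
  by apply: cvgMr; under eq_fun do rewrite expr2; rewrite expr2; exact: cvgM.
by rewrite /affine_sqdist; do 2![apply: cvgB => //]; do 3![apply: cvgD => //].
Qed.

Lemma infinite_set_ge (A : set nat) (N : nat) :
  infinite_set A -> exists2 n, A n & (N <= n)%N.
Proof.
move=> Ainf; apply: contrapT => h; apply: Ainf.
apply: (sub_finite_set _ (finite_II N)) => n An /=.
by rewrite ltnNge; apply/negP => Nn; apply: h; exists n.
Qed.

Section limit.
Context {R : realType} {X : metricType R} {X_ : nat -> metricType R}
  {C_ : nat -> R}.
Hypothesis X_limit : n_point_limit 5 X X_.
Hypothesis X_rcat0 : forall m, rcat0_star (C_ m) (X_ m).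
Local Notation sqd := (affine_sqdist (@mdist R X)).

(** An eventual bound on [C_] suffices, since the approximating indices can be taken arbitrarily
    large; this covers both bounded and vanishing constants. *)
Lemma limit_five (C : R) (x : 'I_3 -> X) (u v : X) (i j : 'I_3) (l m : R) :
  (\forall n \near \oo, C_ n <= C) ->
  i != j -> 0 <= l <= 1 -> 0 <= m <= 1 ->
  mdist u v <=
    Num.sqrt (sqd (x i) (x (i + 1)) (x j) (x (j + 1)) l m) +
    Num.sqrt (sqd (x i) (x (i + 1)) u u l 0) +
    Num.sqrt (sqd (x j) (x (j + 1)) v v m 0) + 3 * C.
Proof.
move=> [N _ CN] ij l01 m01.
(* Indices 0, 1, 2 stand for the vertices, 3 for u and 4 for v. *)
pose e : 'I_3 -> 'I_5 := widen_ord (isT : (3 <= 5)%N).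
pose iu : 'I_5 := Ordinal (isT : (3 < 5)%N).
pose iv : 'I_5 := Ordinal (isT : (4 < 5)%N).
pose pt (k : 'I_5) : X :=
  if (k < 3)%N then x (inord k) else if k == iu then u else v.
have ptx k : pt (e k) = x k.
  by rewrite /pt /= ltn_ord; congr x; apply/val_inj; rewrite /= inordK.
pose D a b := mdist (pt a) (pt b).
pose bound (D : 'I_5 -> 'I_5 -> R) :=
    Num.sqrt (affine_sqdist D (e i) (e (i + 1)) (e j) (e (j + 1)) l m) +
    Num.sqrt (affine_sqdist D (e i) (e (i + 1)) iu iu l 0) +
    Num.sqrt (affine_sqdist D (e j) (e (j + 1)) iv iv m 0) + 3 * C.
suff : D iu iv <= bound D by rewrite /bound /affine_sqdist /D !ptx.
(* Only the distances of the approximating points are kept, because the spaces containing them vary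
   with n. *)
have /choice[D_ D_P] : forall n, exists D' : 'I_5 -> 'I_5 -> R,
    (forall a b, `|D a b - D' a b| < harmonic n) /\ D' iu iv <= bound D'.
  move=> n.
  have [k [y xy] Nk] := infinite_set_ge N (@X_limit pt _ (harmonic_gt0 n)).
  exists (fun a b => mdist (y a) (y b)); split=> //.
  have [H XH] := X_rcat0 k.
  have := rcat0_five XH (y \o e) (y iu) (y iv) ij l01 m01.
  move/le_trans; apply; rewrite lerD2l ler_pM2l//; exact: CN.
have DD a b : D_ n a b @[n --> \oo] --> D a b.
  apply/cvgrPdist_le => r r0.
  have /cvgrPdist_le/(_ r r0) := @cvg_harmonic R.
  apply: filterS => n; rewrite sub0r normrN ger0_norm ?harmonic_ge0// => nr.
  by apply: le_trans nr; apply: ltW; exact: (D_P n).1.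
apply: (ler_cvg_to (DD iu iv) (_ : bound (D_ n) @[n --> \oo] --> _));
  last first.
  by apply: nearW => n; exact: (D_P n).2.
have cvg_sqrt p q r s l' m' :
    Num.sqrt (affine_sqdist (D_ n) p q r s l' m') @[n --> \oo] -->
    Num.sqrt (affine_sqdist D p q r s l' m').
  apply: (cvg_comp (fun n => affine_sqdist (D_ n) p q r s l' m') Num.sqrt).
    exact: cvg_affine_sqdist.
  exact: sqrt_continuous.
by apply: cvgD; [do 2![apply: cvgD => //]|exact: cvg_cst].
Qed.

Lemma limit_five0 (x : 'I_3 -> X) (u v : X) (i j : 'I_3) (l m : R) :
  C_ @ \oo --> 0 -> i != j -> 0 <= l <= 1 -> 0 <= m <= 1 ->
  mdist u v <=
    Num.sqrt (sqd (x i) (x (i + 1)) (x j) (x (j + 1)) l m) +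
    Num.sqrt (sqd (x i) (x (i + 1)) u u l 0) +
    Num.sqrt (sqd (x j) (x (j + 1)) v v m 0).
Proof.
move=> C0 ij l01 m01; apply/ler_addgt0Pr => e e0.
(* e / 3 eventually bounds [C_], and the estimate uses it three times. *)
have -> : e = 3 * (e / 3) by field.
apply: limit_five => //.
have e3 : 0 < e / 3 by rewrite divr_gt0.
have /cvgrPdist_le/(_ _ e3) := C0.
apply: filterS => n; rewrite sub0r normrN; apply: le_trans; exact: ler_norm.
Qed.

End limit.

(** * Heights over the sides of short triangles *)

(** Stewart's expression vanishes at the exact distances l d(x, y) and (1 - l) d(x, y), so only the
    excesses over them contribute. The bounds [l1] and [l2] may be subpath lengths or explicit
    numbers. *)
Lemma affine_sqdist_excess (R : realType) (X : metricType R) (x y u : X)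
    (l h l1 l2 : R) :
  0 <= l <= 1 -> mdist x u <= l1 -> mdist u y <= l2 ->
  l * mdist x y <= l1 -> (1 - l) * mdist x y <= l2 ->
  l1 + l2 <= mdist x y + h ->
  affine_sqdist (@mdist R X) x y u u l 0 <= 2 * mdist x y * h + h ^+ 2.
Proof.
move=> /andP[l0 l1']; set c := mdist x y => xu uy cl1 cl2 ch.
have c0 : 0 <= c by exact: mdist_ge0.
(* l1 and l2 exceed the two parts of the comparison side by a and b, which
   share the total excess h. *)
pose a := l1 - l * c; pose b := l2 - (1 - l) * c.
have a0 : 0 <= a by rewrite subr_ge0.
have b0 : 0 <= b by rewrite subr_ge0.
have ab : a + b <= h by rewrite /a /b; lra.
have l'0 : 0 <= 1 - l by rewrite subr_ge0.
have xu2 : mdist x u ^+ 2 <= l1 ^+ 2 by rewrite ler_pXn2r ?nnegrE ?mdist_ge0//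
  (le_trans (mdist_ge0 x u)).
have uy2 : mdist y u ^+ 2 <= l2 ^+ 2 by rewrite metric_sym ler_pXn2r ?nnegrE
  ?mdist_ge0// (le_trans (mdist_ge0 u y)).
have -> : affine_sqdist (@mdist R X) x y u u l 0 = (1 - l) * mdist x u ^+ 2 +
    l * mdist y u ^+ 2 - l * (1 - l) * c ^+ 2.
  by rewrite /affine_sqdist -/c; ring.
apply: (@le_trans _ _ ((1 - l) * l1 ^+ 2 + l * l2 ^+ 2 - l * (1 - l) * c ^+ 2)).
  by rewrite lerD2r lerD// ler_wpM2l.
(* The terms in c ^+ 2 alone cancel. It remains to use l (1 - l) <= 1, a + b <= h and a, b <= h. *)
have -> : (1 - l) * l1 ^+ 2 + l * l2 ^+ 2 - l * (1 - l) * c ^+ 2 =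
    2 * (l * (1 - l)) * c * (a + b) + ((1 - l) * a ^+ 2 + l * b ^+ 2).
  by rewrite /a /b; ring.
have h0 : 0 <= h by exact: le_trans (addr_ge0 a0 b0) ab.
apply: lerD.
  rewrite -!mulrA ler_pM2l// mulrA.
  apply: (@le_trans _ _ (1 * (c * h))); last by rewrite mul1r.
  apply: ler_pM; rewrite ?mulr_ge0// ?(addr_ge0 a0 b0)//;
    last by rewrite ler_wpM2l.
  by rewrite mulr_ile1// lerBlDr lerDl.
have ah : a ^+ 2 <= h ^+ 2 by rewrite ler_pXn2r ?nnegrE//; lra.
have bh : b ^+ 2 <= h ^+ 2 by rewrite ler_pXn2r ?nnegrE//; lra.
have -> : h ^+ 2 = (1 - l) * h ^+ 2 + l * h ^+ 2 by ring.
by rewrite lerD// ler_wpM2l.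
Qed.

(** If [ub] lies at fraction l, the comparison conditions say that the subpath lengths are at least
    l d(x, y) and (1 - l) d(x, y), as the excess estimate requires. *)
Lemma comparison_point_short (R : realType) (X : metricType R) (h : R) (x y : X)
    (g : path_in X) (t : R) (xb yb ub : 'rV[R]_2) :
  short_segment h x y g -> t \in `[0, path_end g] ->
  edist xb yb = mdist x y -> comparison_point xb yb g t ub ->
  exists l, [/\ 0 <= l <= 1, ub = (1 - l) *: xb + l *: yb &
    affine_sqdist (@mdist R X) x y (g t) (g t) l 0 <=
      2 * mdist x y * h + h ^+ 2].
Proof.
move=> xyg tI xyb [[l /=]]; rewrite in_itv/= => l01 <-.
have [l1 [l2 [-> -> xt ty l12]]] := short_segment_split xyg tI.
case/andP: (l01) => l0 l1'.
rewrite edist_affinel// edist_affiner// xyb !lee_fin => cl1 cl2.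
exists l; split=> //; exact: (affine_sqdist_excess _ xt ty).
Qed.

(** * Geodesics and CAT(0) in a complete limit *)

(** The Lipschitz bounds telescope along every partition of [0, 1], so the length is at most d(x,
    y). *)
Lemma lipschitz_geodesic (R : realType) (X : metricType R) (x y : X)
    (f : R -> X) :
  f 0 = x -> f 1 = y ->
  (forall a b, 0 <= a <= 1 -> 0 <= b <= 1 ->
    mdist (f a) (f b) <= `|a - b| * mdist x y) ->
  exists g : path_in X, short_segment 0 x y g.
Proof.
move=> f0 f1 flip; have d0 := mdist_ge0 x y.
have fcont : {within `[0, 1], continuous f}.
  apply/subspace_continuousP => a; rewrite /= in_itv/= => a01.
  apply/metricType_numDomainType.cvgrPdist_lt => e e0.
  (* Adding 1 keeps the denominator positive when x = y. *)
  have ed0 : 0 < e / (mdist x y + 1) by rewrite divr_gt0// ltr_wpDl.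
  rewrite near_withinE; near=> b; rewrite /= in_itv/= => b01.
  apply: le_lt_trans (flip _ _ a01 b01) _.
  have : `|a - b| < e / (mdist x y + 1).
    by near: b; exact: (@cvgr_dist_lt _ _ _ (nbhs a) _ id a).
  rewrite ltr_pdivlMr ?ltr_wpDl//; apply: le_lt_trans.
  by rewrite ler_wpM2l// lerDl.
exists (@PathIn _ _ 1 f ler01 fcont).
have len_le : (len_between 0 1 f <= (mdist x y)%:E)%E.
  apply: ge_ereal_sup => _ [s s01 <-]; rewrite lee_fin.
  have : forall a, 0 <= a -> itv_partition a 1 s ->
      metric_variation a 1 f s <= (1 - a) * mdist x y.
    elim: s {s01} => [|b s ih] a a0 as1.
      rewrite metric_variation_nil mulr_ge0// subr_ge0.
      exact: itv_partition_le as1.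
    have [ab bs1] : a < b /\ itv_partition b 1 s.
      by case: as1 => /=/andP[].
    have b1 := itv_partition_le bs1.
    have b0 : 0 <= b by rewrite (le_trans a0)// ltW.
    rewrite metric_variation_cons.
    have -> : (1 - a) * mdist x y = (b - a) * mdist x y + (1 - b) * mdist x y.
      by ring.
    rewrite lerD ?ih//.
    have <- : `|a - b| = b - a by rewrite distrC gtr0_norm// subr_gt0.
    by rewrite flip// ?a0 ?b0//= (le_trans (ltW ab)).
  by move/(_ 0 (lexx 0) s01); rewrite subr0 mul1r.
split => //; last by rewrite oppe0 adde0.
by rewrite /len/= -{1}f0 -{1}f1 mdist_le_len.
Unshelve. all: by end_near. Qed.

Section complete_limit.
Context {R : realType} {X : metricType R} {X_ : nat -> metricType R}
  {C_ : nat -> R}.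
Hypothesis X_limit : n_point_limit 5 X X_.
Hypothesis X_rcat0 : forall m, rcat0_star (C_ m) (X_ m).
Hypothesis C0 : C_ @ \oo --> 0.
Hypothesis X_length : length_space X.
Hypothesis X_complete : complete_space X.
Local Notation sqd := (affine_sqdist (@mdist R X)).

(* The triangle with vertices x, y, x compares with a segment of the line. *)
Lemma limit_near_segment (x y u v : X) (l k : R) :
  0 <= l <= 1 -> 0 <= k <= 1 ->
  mdist u v <= `|l - k| * mdist x y + Num.sqrt (sqd x y u u l 0) +
    Num.sqrt (sqd x y v v k 0).
Proof.
(* The second side runs from y back to x, so fraction k becomes 1 - k. *)
move=> l01 k01; have k'01 : 0 <= 1 - k <= 1 by lra.
have := limit_five0 X_limit X_rcat0 (ord3_fun x y x) u v
  C0 (isT : 0 != 1 :> 'I_3) l01 k'01.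
rewrite /=.
have -> : sqd x y y x l (1 - k) = ((l - k) * mdist x y) ^+ 2.
  by rewrite /affine_sqdist !mdistxx (metric_sym y x); ring.
have -> : sqd y x v v (1 - k) 0 = sqd x y v v k 0.
  by rewrite /affine_sqdist (metric_sym y x); ring.
by rewrite sqrtr_sqr normrM (ger0_norm (mdist_ge0 x y)).
Qed.

Lemma approx_point (x y : X) (l e : R) : 0 <= l <= 1 -> 0 < e ->
  exists u, [/\ mdist x u = l * mdist x y,
    mdist u y <= (1 - l) * mdist x y + e &
    sqd x y u u l 0 <= 2 * mdist x y * e + e ^+ 2].
Proof.
move=> l01 e0; have [g xyg] := X_length x y e0.
have [t tI gt] := short_segment_ivt xyg l01.
have [l1 [l2 [_ _ xt ty l12]]] := short_segment_split xyg tI.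
have uy : mdist (g t) y <= (1 - l) * mdist x y + e by lra.
exists (g t); split=> //.
apply: (@affine_sqdist_excess _ _ _ _ _ l e (l * mdist x y)
  ((1 - l) * mdist x y + e)) => //.
- by rewrite gt.
- by rewrite lerDl ltW.
- by rewrite addrA -mulrDl (addrC l) subrK mul1r.
Qed.

Lemma segment_point (x y : X) (l : R) : 0 <= l <= 1 ->
  exists u, mdist x u = l * mdist x y /\ mdist u y <= (1 - l) * mdist x y.
Proof.
move=> l01.
have /choice[u uP] := fun n => approx_point x y l01 (harmonic_gt0 n).
(* [r n] bounds the height of [u n] over the segment from x to y. *)
pose r n := Num.sqrt (2 * mdist x y * harmonic n + harmonic n ^+ 2) : R.
have r0 : r n @[n --> \oo] --> (0 : R).
  rewrite -(@sqrtr0 R).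
  apply: (cvg_comp (fun n => 2 * mdist x y * harmonic n + harmonic n ^+ 2)
    Num.sqrt); last exact: sqrt_continuous.
  have h0 := @cvg_harmonic R.
  have h1 : 2 * mdist x y * harmonic n @[n --> \oo] --> 2 * mdist x y * 0.
    exact: cvgMr.
  have h2 : harmonic n ^+ 2 @[n --> \oo] --> (0 * 0 : R).
    by under eq_fun do rewrite expr2; exact: cvgM.
  by have := cvgD h1 h2; rewrite !mulr0 addr0; apply.
have u_cauchy : cauchy (u @ \oo).
  apply/cauchy_ballP => e e0.
  have /cvgrPdist_lt/(_ _ (divr_gt0 e0 (ltr0n _ 2))) [N _ rN] := r0.
  have rlt n : (N <= n)%N -> r n < e / 2.
    by move=> /rN /=; rewrite sub0r normrN; apply: le_lt_trans; exact: ler_norm.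
  exists (u @` [set n | (N <= n)%N], u @` [set n | (N <= n)%N]).
    by split=> /=; exists N => // n /= Nn; exists n.
  move=> [_ _] /= [[n Nn <-] [m Nm <-]]; rewrite ballEmdist /=.
  (* At equal fractions the planar term vanishes and only the two heights remain. *)
  have := limit_near_segment x y (u n) (u m) l01 l01.
  rewrite subrr normr0 mul0r add0r => /le_lt_trans; apply.
  rewrite (splitr e) ltrD//.
    by apply: le_lt_trans (rlt _ Nn); apply: ler_wsqrtr; case: (uP n).
  by apply: le_lt_trans (rlt _ Nm); apply: ler_wsqrtr; case: (uP m).
have [p up] := X_complete u_cauchy.
have distp z : mdist z (u n) @[n --> \oo] --> mdist z p.
  by apply: (cvg_comp u (mdist z)) up _; exact: mdist_continuous.
exists p; split.
  have xu : mdist x (u n) @[n --> \oo] --> l * mdist x y.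
    rewrite (_ : (fun n => _) = cst (l * mdist x y)); first exact: cvg_cst.
    by apply/funext => n; case: (uP n).
  exact: (cvg_unique (@norm_hausdorff _ R) (distp x) xu).
rewrite metric_sym.
apply: (ler_cvg_to (distp y) (g := fun n => (1 - l) * mdist x y + harmonic n)).
  have := cvgD (cvg_cst ((1 - l) * mdist x y)) (@cvg_harmonic R).
  by rewrite addr0; apply.
by apply: nearW => n; rewrite metric_sym; case: (uP n).
Qed.

(** Points at exact fractions have height 0, so even independent choices satisfy the Lipschitz
    bound. *)
Lemma limit_geodesic : geodesic_space X.
Proof.
move=> x y.
have /choice[f fP] : forall l, exists u, 0 <= l <= 1 ->
    mdist x u = l * mdist x y /\ mdist u y <= (1 - l) * mdist x y.
  move=> l; case: (boolP (0 <= l <= 1)) => [/(segment_point x y)[u uP]|_].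
    by exists u.
  (* An arbitrary value outside [0, 1]. *)
  by exists x.
apply: (@lipschitz_geodesic _ _ _ _ f) => [||a b a01 b01].
- have [|] := fP 0; first by rewrite lexx ler01.
  by rewrite mul0r => /mdist_positivity.
- have [|] := fP 1; first by rewrite lexx ler01.
  rewrite subrr mul0r => _ fy; apply: mdist_positivity.
  by apply/le_anti; rewrite fy mdist_ge0.
have sqd0 l : 0 <= l <= 1 -> Num.sqrt (sqd x y (f l) (f l) l 0) = 0.
  move=> l01; have [xf fy] := fP l l01; apply: ler0_sqrtr.
  have := @affine_sqdist_excess _ _ x y (f l) l 0 (l * mdist x y)
    ((1 - l) * mdist x y).
  rewrite mulr0 expr0n /= !addr0; apply => //; first by rewrite xf.
  by rewrite -mulrDl (addrC l) subrK mul1r.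
have := limit_near_segment x y (f a) (f b) a01 b01.
by rewrite !sqd0// !addr0.
Qed.

(** On sides with h = 0 both heights vanish, leaving only the planar comparison distance. *)
Lemma limit_cat0 : cat0 X.
Proof.
split; first exact: limit_geodesic.
move=> x g xb t s ub vb xg xxb tI sI ubP vbP.
have e20 : (2 + 1 : 'I_3) = 0 by exact/val_inj.
have xg0 := xg 0; have xg2 := xg 2; rewrite add0r e20 in xg0 xg2.
have [l [l01 ubE qu]] := comparison_point_short xg0 tI (xxb _ _) ubP.
have [m [m01 vbE qv]] := comparison_point_short xg2 sI (xxb _ _) vbP.
have := limit_five0 X_limit X_rcat0 x (g 0 t) (g 2 s)
  C0 (isT : 0 != 2 :> 'I_3) l01 m01.
rewrite add0r e20 [Num.sqrt (sqd _ _ (g 0 t) _ _ _)]ler0_sqrtr; last first.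
  by apply: le_trans qu _; rewrite mulr0 expr0n addr0.
rewrite [Num.sqrt (sqd _ _ (g 2 s) _ _ _)]ler0_sqrtr; last first.
  by apply: le_trans qv _; rewrite mulr0 expr0n addr0.
rewrite !addr0 ubE vbE edist_affine.
by have := affine_sqdist_comparison 0 2 l m xxb; rewrite add0r e20 => ->.
Qed.

End complete_limit.

(** * Rough CAT(0) for uniformly bounded constants *)

Lemma limit_rcat0 (R : realType) (X : metricType R)
    (X_ : nat -> metricType R) (C_ : nat -> R) (C : R) :
  length_space X -> n_point_limit 5 X X_ ->
  (forall m, rcat0_star (C_ m) (X_ m)) -> (forall m, C_ m <= C) ->
  rcat0 (3 * C + 2 * Num.sqrt 3) X.
Proof.
move=> X_length X_limit X_rcat0 CC.
have maxgt0 (a : R) : 0 < Num.max 1 a by rewrite lt_max ltr01.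
split => // [|x y z|x g xb i j t s ub vb].
- have [H [C0 _ _ _]] := X_rcat0 0.
  by rewrite ltr_wpDr ?mulr_ge0 ?sqrtr_ge0// mulr_gt0// (lt_le_trans C0).
- by rewrite divr_gt0.
set M := Num.max 1 _ => xg xxb ij tI sI ubP vbP.
have [l [l01 ubE qu]] := comparison_point_short (xg i) tI (xxb _ _) ubP.
have [m [m01 vbE qv]] := comparison_point_short (xg j) sI (xxb _ _) vbP.
have M0 : 0 < M by exact: maxgt0.
have side_le k : mdist (x k) (x (k + 1)) <= M.
  rewrite /M !le_max; elim/ord3_ind: k => /=.
  - by rewrite add0r lexx orbT.
  - by rewrite lexx !orbT.
  - have -> : (1 + 1 + 1 : 'I_3) = 0 by exact/val_inj.
    by rewrite metric_sym lexx !orbT.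
have h1 : 1 / M <= 1 by rewrite ler_pdivrMr// mul1r le_max lexx.
(* With h = 1 / M, d <= M and M >= 1, the bound 2 d h + h ^+ 2 is at most 2 + 1; each height thus
   contributes at most the square root of 3. *)
have excess_le k :
    2 * mdist (x k) (x (k + 1)) * (1 / M) + (1 / M) ^+ 2 <= 3.
  have : mdist (x k) (x (k + 1)) * (1 / M) <= 1.
    by rewrite mulrA mulr1 ler_pdivrMr// mul1r.
  have : (1 / M) ^+ 2 <= 1 by rewrite exprn_ile1// divr_ge0// ltW.
  by rewrite -mulrA; lra.
have C_near : \forall n \near \oo, C_ n <= C by exact: nearW.
have := limit_five X_limit X_rcat0 x (g i t) (g j s) C_near ij l01 m01.
rewrite ubE vbE edist_affine (affine_sqdist_comparison _ _ _ _ xxb).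
have := ler_wsqrtr (le_trans qu (excess_le i)).
have := ler_wsqrtr (le_trans qv (excess_le j)).
lra.
Qed.

Theorem theorem4p16 (R : realType) (X : metricType R)
    (X_ : nat -> metricType R) (C_ : nat -> R) :
  length_space X ->
  n_point_limit 5 X X_ ->
  (forall m, rcat0_star (C_ m) (X_ m)) ->
  (forall C : R, (forall m, C_ m <= C) ->
     rcat0 (3 * C + 2 * Num.sqrt 3) X) /\
  (C_ @ \oo --> 0 -> complete_space X -> cat0 X).
Proof.
move=> X_length X_limit X_rcat0; split=> [C C_le|C0 X_complete].
  exact: (limit_rcat0 X_length X_limit X_rcat0 C_le).
exact: (limit_cat0 X_limit X_rcat0).
Qed.
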